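(* Let $n$ be a positive integer. For every square matrix $A\in\mathbb{C}^{n\times n}$ with Moore-Penrose inverse $A^\dag$ and Drazin inverse $A^d$, we have $$\|AA^\dag-AA^d\|_F\ge \sqrt{\|m(AA^d)-AA^d\|_F^2+\mathrm{rank}(A)-\mathrm{rank}(A^d)},$$ where $m(AA^d)$ is the matched projection of the idempotent $AA^d$. Moreover, equality occurs if and only if $AA^d$ is a projection.
   Context: An idempotent is a matrix $Q$ with $Q^2=Q$; a projection is a Hermitian idempotent. $A^d$ denotes the Drazin inverse of a square matrix $A$: the unique matrix $X$ with $AX=XA$, $XAX=X$ and $A^{k+1}X=A^k$ for some integer $k\ge 0$; $AA^d$ is an idempotent. $\|\cdot\|_F$ is the Frobenius norm, $A^*$ the conjugate transpose, and $|B|=(B^*B)^{1/2}$ the positive semi-definite square root, so $|Q^*|=(QQ^* )^{1/2}$. For an idempotent $Q\in\mathbb{C}^{n\times n}$ the matched projection is $$m(Q)=\tfrac12\big(|Q^*|+Q^*\big)\,|Q^*|^\dag\,\big(|Q^*|+I_n\big)^{-1}\big(|Q^*|+Q\big),$$ which is known to be a projection. *)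

(* Defs.v *)
From mathcomp Require Import all_boot all_order all_algebra.
From mathcomp Require Import boolp classical_sets reals.
From mathcomp Require Import complex.

Set Implicit Arguments.
Unset Strict Implicit.
Unset Printing Implicit Defensive.

Import Order.TTheory GRing.Theory Num.Theory.

Local Open Scope classical_set_scope.
Local Open Scope sesquilinear_scope.
Local Open Scope ring_scope.

Section Notions.
Variable C : numClosedFieldType.

Definition idempotentmx n (Q : 'M[C]_n) : Prop := Q *m Q = Q.

Definition projectionmx n (Q : 'M[C]_n) : Prop :=
  idempotentmx Q /\ Q \is hermsymmx.

(* In [C], [0 <= z] says that z is real and nonnegative. *)
Definition psdmx n (A : 'M[C]_n) : Prop :=
  A \is hermsymmx /\ forall v : 'cV[C]_n, 0 <= (v^t* *m A *m v) 0 0.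

(* [psd_sqrt], [mpinv] and [drazin] select the unique matrix with the defining
   property: [mpinv] and [drazin] always exist ([mpinvP], [drazinP]), and
   [psd_sqrt A] exists for [psdmx A] ([psd_sqrtP]) and is [0] when no such matrix
   exists.  Uniqueness is [mpinv_uniq], [drazin_uniq] and [psd_sqrt_uniq]. *)
Definition is_psd_sqrt n (A X : 'M[C]_n) : Prop := psdmx X /\ X *m X = A.

Definition psd_sqrt n (A : 'M[C]_n) : 'M[C]_n := xget 0 [set X | is_psd_sqrt A X].

Definition is_mpinv m n (A : 'M[C]_(m, n)) (X : 'M[C]_(n, m)) : Prop :=
  [/\ A *m X *m A = A, X *m A *m X = X,
      A *m X \is hermsymmx & X *m A \is hermsymmx].

Definition mpinv m n (A : 'M[C]_(m, n)) : 'M[C]_(n, m) :=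
  xget 0 [set X | is_mpinv A X].

Definition is_drazin n (A X : 'M[C]_n) : Prop :=
  [/\ A *m X = X *m A, X *m A *m X = X &
      exists k : nat, A ^+ k.+1 *m X = A ^+ k].

Definition drazin n (A : 'M[C]_n) : 'M[C]_n := xget 0 [set X | is_drazin A X].

Definition mxabs m n (B : 'M[C]_(m, n)) : 'M[C]_n := psd_sqrt (B^t* *m B).

(* [(mxabs Q^t* + 1%:M)] is invertible by [mxabs_add1_unit], so [invmx] is its
   genuine inverse. *)
Definition matched_proj n (Q : 'M[C]_n) : 'M[C]_n :=
  2^-1 *: (mxabs (Q^t*) + Q^t*) *m mpinv (mxabs (Q^t*))
    *m invmx (mxabs (Q^t*) + 1%:M) *m (mxabs (Q^t*) + Q).

End Notions.

Definition frobenius_norm (R : rcfType) m n (A : 'M[R[i]]_(m, n)) : R :=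
  Num.sqrt (\sum_i \sum_j Normc.normc (A i j) ^+ 2).

Section WellDefined.
Variable C : numClosedFieldType.
Implicit Types m n p : nat.

Lemma hermsymmxE n (A : 'M[C]_n) : (A \is hermsymmx) = (A == A^t*).
Proof. by rewrite qualifE /= expr0 scale1r. Qed.

Lemma hermsymmxC n (A : 'M[C]_n) : A \is hermsymmx -> A^t* = A.
Proof. by rewrite hermsymmxE => /eqP <-. Qed.

Lemma trmxC_mul m n p (A : 'M[C]_(m, n)) (B : 'M[C]_(n, p)) :
  (A *m B)^t* = B^t* *m A^t*.
Proof. by rewrite trmx_mul map_mxM. Qed.

Lemma mxtrace_gram m n (M : 'M[C]_(m, n)) :
  \tr (M^t* *m M) = \sum_j \sum_i `|M i j| ^+ 2.
Proof.
apply: eq_bigr => j _; rewrite !mxE; apply: eq_bigr => i _.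
by rewrite !mxE normCKC.
Qed.

Lemma mxtrace_gram_eq0 m n (M : 'M[C]_(m, n)) :
  \tr (M^t* *m M) = 0 -> M = 0.
Proof.
rewrite mxtrace_gram => /eqP.
rewrite psumr_eq0; last by move=> j _; apply: sumr_ge0 => i _; rewrite exprn_ge0.
move=> /allP M0; apply/matrixP => i j; rewrite mxE.
have := M0 j (mem_index_enum _); rewrite /= psumr_eq0; last first.
  by move=> k _; rewrite exprn_ge0.
move=> /allP /(_ i (mem_index_enum _)) /=.
by rewrite expf_eq0 /= normr_eq0 => /eqP.
Qed.

Lemma mxtrace_gram_ge0 m n (M : 'M[C]_(m, n)) : 0 <= \tr (M^t* *m M).
Proof.
by rewrite mxtrace_gram; do 2!apply: sumr_ge0 => ? _; rewrite exprn_ge0.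
Qed.

Lemma gram_eq0 m n (M : 'M[C]_(m, n)) : M^t* *m M = 0 -> M = 0.
Proof. by move=> M0; apply: mxtrace_gram_eq0; rewrite M0 mxtrace0. Qed.

Lemma psdmx_congr m n (A : 'M[C]_n) (M : 'M[C]_(n, m)) :
  psdmx A -> psdmx (M^t* *m A *m M).
Proof.
case; rewrite hermsymmxE => /eqP hA pA; split.
  by rewrite hermsymmxE !trmxC_mul trmxCK -hA mulmxA.
by move=> v; have := pA (M *m v); rewrite trmxC_mul !mulmxA.
Qed.

Lemma psdmx1 n : psdmx (1%:M : 'M[C]_n).
Proof.
split; first by rewrite hermsymmxE trmx1 map_mx1.
move=> v; rewrite mulmx1 mxE; apply: sumr_ge0 => i _.
by rewrite !mxE mulrC mul_conjC_ge0.
Qed.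

Lemma psdmx_gram m n (M : 'M[C]_(n, m)) : psdmx (M^t* *m M).
Proof. by have := psdmx_congr M (psdmx1 n); rewrite mulmx1. Qed.

Lemma psdmx_diag n (d : 'rV[C]_n) : (forall i, 0 <= d 0 i) -> psdmx (diag_mx d).
Proof.
move=> d_ge0; split.
  rewrite hermsymmxE tr_diag_mx map_diag_mx; apply/eqP; congr diag_mx.
  by apply/rowP => i; rewrite mxE /= (conj_Creal (ger0_real (d_ge0 i))).
move=> v; rewrite mul_mx_diag mxE; apply: sumr_ge0 => i _.
by rewrite !mxE mulrAC mulr_ge0 // mulrC mul_conjC_ge0.
Qed.

Lemma psd_sqrt_ex n (A : 'M[C]_n) : psdmx A -> exists X, is_psd_sqrt A X.
Proof.
move=> [hA pA]; have /orthomx_spectralP := hermitian_normalmx hA.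
set P := spectralmx A; set d := spectral_diag A => AE.
have uP : P \is unitarymx by exact: spectral_unitarymx.
have PV : P *m P^t* = 1%:M by apply/unitarymxP.
rewrite invmx_unitary // in AE.
have d_ge0 i : 0 <= d 0 i.
  have := pA ((row i P)^t*); rewrite trmxCK.
  have -> : row i P *m A *m (row i P)^t* = row i (diag_mx d) *m (delta_mx 0 i)^T.
    rewrite rowE trmxC_mul AE !mulmxA -[X in X *m diag_mx d]mulmxA PV mulmx1.
    rewrite -[X in X *m (delta_mx 0 i)^t* = _]mulmxA PV mulmx1 -rowE; congr (_ *m _).
    by apply/matrixP => j k; rewrite !mxE conjC_nat.
  by rewrite trmx_delta -colE !mxE eqxx mulr1n.
exists (P^t* *m diag_mx (map_mx sqrtC d) *m P); split.
  by apply/psdmx_congr/psdmx_diag => i; rewrite mxE sqrtC_ge0.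
rewrite !mulmxA -[X in X *m diag_mx _ *m P]mulmxA PV mulmx1.
rewrite -(mulmxA (P^t*)) mulmx_diag [RHS]AE; congr (_ *m diag_mx _ *m _).
by apply/rowP => i; rewrite !mxE -expr2 sqrtCK.
Qed.

Lemma psd_sqrt_uniq n (A X Y : 'M[C]_n) :
  is_psd_sqrt A X -> is_psd_sqrt A Y -> X = Y.
Proof.
move=> [pX XX] [pY YY]; apply/eqP; rewrite -subr_eq0; apply/eqP.
set D := X - Y.
have hD : D^t* = D.
  by rewrite /D linearB /= map_mxB (hermsymmxC pX.1) (hermsymmxC pY.1).
have [S [[hS _] SX]] := psd_sqrt_ex pX; have [T [[hT _] TY]] := psd_sqrt_ex pY.
have DX : (S *m D)^t* *m (S *m D) = D *m X *m D.
  by rewrite trmxC_mul hD (hermsymmxC hS) -SX !mulmxA.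
have DY : (T *m D)^t* *m (T *m D) = D *m Y *m D.
  by rewrite trmxC_mul hD (hermsymmxC hT) -TY !mulmxA.
have D0 : X *m D + D *m Y = 0.
  by rewrite mulmxBr mulmxBl XX YY addrA subrK subrr.
have : \tr (D *m X *m D) + \tr (D *m Y *m D) = 0.
  rewrite [X in _ + X]mxtrace_mulC mulmxA -mxtraceD.
  by rewrite -[D *m X *m D]mulmxA -[D *m D *m Y]mulmxA -mulmxDr D0 mulmx0 mxtrace0.
move/eqP; rewrite -DX -DY paddr_eq0 ?mxtrace_gram_ge0 // => /andP[/eqP SD /eqP TD].
apply: gram_eq0; rewrite hD.
have -> : D *m D = X *m D - Y *m D by rewrite -mulmxBl.
rewrite -SX -TY -!mulmxA.
by rewrite (mxtrace_gram_eq0 SD) (mxtrace_gram_eq0 TD) !mulmx0 subrr.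
Qed.

Lemma psd_sqrtP n (A : 'M[C]_n) : psdmx A -> is_psd_sqrt A (psd_sqrt A).
Proof. by move/psd_sqrt_ex; apply: xgetPex. Qed.

Lemma mxabsP m n (B : 'M[C]_(m, n)) :
  psdmx (mxabs B) /\ mxabs B *m mxabs B = B^t* *m B.
Proof. exact: psd_sqrtP (psdmx_gram B). Qed.

Lemma mxabs_add1_unit m n (B : 'M[C]_(m, n)) : mxabs B + 1%:M \in unitmx.
Proof.
have [[_ pB] _] := mxabsP B; rewrite -row_free_unit -kermx_eq0.
apply/rowV0P => u /sub_kermxP u0.
have : (u *m (mxabs B + 1%:M) *m u^t*) 0 0 = 0 by rewrite u0 mul0mx mxE.
rewrite mulmxDr mulmxDl mulmx1 mxE => /eqP.
have [_ p1] := psdmx1 n.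
have := pB (u^t*); have := p1 (u^t*); rewrite trmxCK mulmx1 => u_ge0 pu.
rewrite paddr_eq0 // => /andP[_ /eqP uu].
rewrite -[u]trmxCK (@gram_eq0 _ _ (u^t*)) ?trmx0 ?map_mx0 // trmxCK.
by rewrite [LHS]mx11_scalar uu raddf0.
Qed.

Lemma gram_unit m n (G : 'M[C]_(m, n)) : row_free G -> G *m G^t* \in unitmx.
Proof.
move=> fG; rewrite -row_free_unit -kermx_eq0; apply/rowV0P => u /sub_kermxP u0.
apply: (row_free_inj fG); rewrite mul0mx -[u *m G]trmxCK.
rewrite (@gram_eq0 _ _ ((u *m G)^t*)) ?trmx0 ?map_mx0 // trmxCK trmxC_mul.
by rewrite mulmxA -(mulmxA u) u0 mul0mx.
Qed.

Lemma mpinv_ex m n (A : 'M[C]_(m, n)) : exists X, is_mpinv A X.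
Proof.
have [r [F [G [AE fF fG]]]] : exists r (F : 'M[C]_(m, r)) (G : 'M[C]_(r, n)),
    [/\ A = F *m G, row_full F & row_free G].
  by exists (\rank A), (col_base A), (row_base A);
    rewrite mulmx_base col_base_full row_base_free.
have uG : G *m G^t* \in unitmx by exact: gram_unit.
have uF : F^t* *m F \in unitmx.
  rewrite -[X in _ *m X]trmxCK; apply: gram_unit.
  by rewrite /row_free mxrank_map mxrank_tr.
set V := invmx (G *m G^t*); set U := invmx (F^t* *m F).
have hV : V^t* = V.
  by rewrite /V trmx_inv map_invmx trmxC_mul trmxCK.
have hU : U^t* = U.
  by rewrite /U trmx_inv map_invmx trmxC_mul trmxCK.
have AX : A *m (G^t* *m V *m U *m F^t*) = F *m U *m F^t*.
  by rewrite AE !mulmxA -(mulmxA F G) -(mulmxA F) mulmxV // mulmx1.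
have XA : (G^t* *m V *m U *m F^t*) *m A = G^t* *m V *m G.
  by rewrite AE !mulmxA -[X in X *m G]mulmxA -[X in X *m G]mulmxA mulVmx // mulmx1.
exists (G^t* *m V *m U *m F^t*); split.
- by rewrite AX AE !mulmxA -[X in X *m G]mulmxA -[X in X *m G]mulmxA mulVmx ?mulmx1.
- by rewrite XA !mulmxA -[X in X *m V *m U]mulmxA -[X in X *m U]mulmxA mulmxV ?mulmx1.
- by rewrite AX hermsymmxE !trmxC_mul trmxCK hU mulmxA.
- by rewrite XA hermsymmxE !trmxC_mul trmxCK hV mulmxA.
Qed.

Lemma mpinv_uniq m n (A : 'M[C]_(m, n)) (X Y : 'M[C]_(n, m)) :
  is_mpinv A X -> is_mpinv A Y -> X = Y.
Proof.
move=> [X1 X2 /hermsymmxC X3 /hermsymmxC X4] [Y1 Y2 /hermsymmxC Y3 /hermsymmxC Y4].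
have E1 : A *m X = A *m Y.
  by rewrite -X3 -{1}Y1 -[A *m Y *m A *m X]mulmxA trmxC_mul X3 Y3 mulmxA X1.
have E2 : X *m A = Y *m A.
  by rewrite -X4 -{1}Y1 -(mulmxA A) mulmxA trmxC_mul X4 Y4 -mulmxA [A *m (X *m A)]mulmxA X1.
by rewrite -X2 E2 -mulmxA E1 mulmxA Y2.
Qed.

Lemma mpinvP m n (A : 'M[C]_(m, n)) : is_mpinv A (mpinv A).
Proof. exact: xgetPex (mpinv_ex A). Qed.

Lemma drazin_ex n (A : 'M[C]_n) : exists X, is_drazin A X.
Proof.
case: n A => [|n] A; first exists 0.
  by split; last exists 0%N; apply/matrixP => -[].
have [k [q q0 pE]] := multiplicity_XsubC (char_poly A) 0.
rewrite monic_neq0 ?char_poly_monic //= subr0 in q0 pE.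
have cop : coprimep (('X : {poly C}) ^+ k.+1) q.
  by rewrite coprimep_expl // coprimep_sym -['X]subr0 coprimep_XsubC.
have /Bezout_eq1_coprimepP [[u v] /= uvE] := cop.
pose Xp : {poly C} := 'X; pose B := horner_mx A u.
have cAB : A * B = B * A.
  have : horner_mx A ('X * u) = horner_mx A (u * 'X) by rewrite mulrC.
  by rewrite !rmorphM /= horner_mx_X.
have AB : A ^+ k = A ^+ k.+1 * (A ^+ k * B).
  have : horner_mx A (Xp ^+ k * (u * Xp ^+ k.+1 + v * q)) = A ^+ k.
    by rewrite uvE mulr1 rmorphXn /= horner_mx_X.
  rewrite mulrDr [_ * (v * q)]mulrCA [_ * q]mulrC -pE rmorphD /= [X in _ + X]rmorphM /=.
  rewrite Cayley_Hamilton mulr0 addr0 => {1}<-.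
  rewrite [u * _]mulrC [X in horner_mx A X]mulrA !rmorphM /= !rmorphXn /= horner_mx_X.
  by rewrite !mulrA -!exprD addnC.
have {AB} [Y cY YE] : exists2 Y, A * Y = Y * A & A ^+ k = A ^+ k.+1 * Y.
  exists (A ^+ k * B) => //.
  by rewrite mulrA -exprS exprSr -!mulrA cAB.
have cXY j l : GRing.comm (A ^+ j) (Y ^+ l) by exact/commrX/commr_sym/commrX/commr_sym.
have AY j : A ^+ k * (A * Y) ^+ j = A ^+ k.
  by elim: j => [|j IH]; rewrite ?mulr1 // exprS mulrA [X in X * _]mulrA -exprSr -YE.
have cAY : GRing.comm A Y by [].
exists (A ^+ k * Y ^+ k.+1); split.
- change (A * (A ^+ k * Y ^+ k.+1) = A ^+ k * Y ^+ k.+1 * A).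
  by rewrite mulrA -exprS exprSr -!mulrA; congr (_ * _); exact: (cXY 1%N k.+1).
- change (A ^+ k * Y ^+ k.+1 * A * (A ^+ k * Y ^+ k.+1) = A ^+ k * Y ^+ k.+1).
  rewrite -!mulrA [A * _]mulrA -exprS [Y ^+ k.+1 * _]mulrA -(cXY k.+1 k.+1).
  by rewrite -exprMn_comm // mulrA AY.
- exists k; change (A ^+ k.+1 * (A ^+ k * Y ^+ k.+1) = A ^+ k).
  by rewrite mulrA -exprD addnC exprD -mulrA -exprMn_comm // AY.
Qed.

Lemma drazin_uniq n (A X Y : 'M[C]_n) : is_drazin A X -> is_drazin A Y -> X = Y.
Proof.
have pow (Z : 'M[C]_n) : A * Z = Z * A -> Z * A * Z = Z ->
    forall j, Z = A ^+ j * Z ^+ j.+1 /\ Z = Z ^+ j.+1 * A ^+ j.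
  move=> cZ ZZ; elim=> [|j [IH1 IH2]]; first by rewrite expr1 mul1r mulr1.
  split.
    by rewrite [A ^+ _]exprS [Z ^+ _]exprSr -mulrA [A ^+ j * _]mulrA -IH1 mulrA cZ.
  by rewrite [Z ^+ _]exprS [A ^+ _]exprSr -mulrA [Z ^+ _ * _]mulrA -IH2 -cZ mulrA.
case=> cX X2 [k Xk] [cY Y2 [l Yl]].
have [XE _] := pow X cX X2 l; have [_ YE] := pow Y cY Y2 k.
have cYl : Y * A ^+ l.+1 = A ^+ l.
  have Yl' : A ^+ l.+1 * Y = A ^+ l by [].
  have cYA : GRing.comm Y A by exact: esym cY.
  by rewrite -[RHS]Yl'; exact: commrX cYA.
have Xk' : A ^+ k.+1 * X = A ^+ k by [].
transitivity (Y * A * X).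
  by rewrite XE mulrA -[Y * A * _]mulrA -exprS cYl.
by rewrite [in LHS]YE -!mulrA [A ^+ k * _]mulrA -exprSr Xk' -YE.
Qed.

Lemma drazinP n (A : 'M[C]_n) : is_drazin A (drazin A).
Proof. exact: xgetPex (drazin_ex A). Qed.

End WellDefined.

(* Main.v *)
(* Write Q = A A^d, T = |Q^*|, and let E = T T^+ be the orthogonal projection onto
   the range of Q, so that E Q = Q and Q E = E.  Then m(Q) is a projection with
   tr m(Q) = tr Q and 2 tr (m(Q) Q) = tr E + tr T, while A A^+ fixes the range of Q.
   Expanding both squared norms, their difference is
   [||A A^+ - Q||^2 - ||m(Q) - Q||^2 - rank A + rank A^d = tr T - tr E], and
   [T - E = N N^* (T + 1)^-1] with [N = Q - E], so that this trace is nonnegative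
   and vanishes exactly when [N = 0], that is when Q is Hermitian. *)
Require Import Defs.
From mathcomp Require Import all_boot all_order all_algebra.
From mathcomp Require Import reals complex ring.

Set Implicit Arguments.
Unset Strict Implicit.
Unset Printing Implicit Defensive.

Import Order.TTheory GRing.Theory Num.Theory.
Local Open Scope ring_scope.
Local Open Scope sesquilinear_scope.

(** * Traces and conjugate transposes *)

Section Adjoint.
Variable C : numClosedFieldType.

(** For a full-rank factorization [Q = F G], cancelling [F] and [G] in [F G F G = F G] gives
    [G F = 1], of size the rank. *)
Lemma mxtrace_idempotent n (Q : 'M[C]_n) : Q *m Q = Q -> \tr Q = (\rank Q)%:R.
Proof.
move=> QQ; rewrite -{1}(mulmx_base Q) mxtrace_mulC.
suff -> : row_base Q *m col_base Q = 1%:M by rewrite mxtrace1.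
apply: (row_free_inj (row_base_free Q)); apply: (row_full_inj (col_base_full Q)).
by rewrite mul1mx -(mulmxA (row_base Q)) mulmx_base (mulmxA (col_base Q)) mulmx_base QQ.
Qed.

Lemma trmxCB m n (A B : 'M[C]_(m, n)) : (A - B)^t* = A^t* - B^t*.
Proof. by rewrite linearB /= map_mxB. Qed.

Lemma trmxCD m n (A B : 'M[C]_(m, n)) : (A + B)^t* = A^t* + B^t*.
Proof. by rewrite linearD /= map_mxD. Qed.

Lemma mxtraceC n (A : 'M[C]_n) : \tr (A^t*) = (\tr A)^*.
Proof. by rewrite rmorph_sum; apply: eq_bigr => i _; rewrite !mxE. Qed.

Lemma psdmxD n (A B : 'M[C]_n) : psdmx A -> psdmx B -> psdmx (A + B).
Proof.
move=> [/hermsymmxC hA pA] [/hermsymmxC hB pB]; split.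
  by rewrite hermsymmxE trmxCD hA hB.
by move=> v; rewrite mulmxDr mulmxDl mxE addr_ge0.
Qed.

(** The adjoints of the four Penrose equations are again Penrose equations for [T], so uniqueness
    applies. *)
Lemma mpinv_herm n (T : 'M[C]_n) : T^t* = T -> (mpinv T)^t* = mpinv T.
Proof.
move=> hT; have [T1 T2 /hermsymmxC T3 /hermsymmxC T4] := mpinvP T.
have TS : T *m (mpinv T)^t* = mpinv T *m T by rewrite -[RHS]T4 trmxC_mul hT.
have ST : (mpinv T)^t* *m T = T *m mpinv T by rewrite -[RHS]T3 trmxC_mul hT.
apply: mpinv_uniq (mpinvP T); split.
- by have := congr1 (fun X => X^t*) T1; rewrite !trmxC_mul hT mulmxA.
- by have := congr1 (fun X => X^t*) T2; rewrite !trmxC_mul hT mulmxA.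
- by rewrite TS hermsymmxE T4.
- by rewrite ST hermsymmxE T3.
Qed.

(** Serves for both squared norms, with [P] equal to [A A^+] and to [m(Q)]. *)
Lemma mxtrace_gram_projB n (P Q : 'M[C]_n) : P *m P = P -> P^t* = P ->
  \tr ((P - Q)^t* *m (P - Q)) =
  \tr P - \tr (P *m Q) - (\tr (P *m Q))^* + \tr (Q^t* *m Q).
Proof.
move=> PP hP; rewrite trmxCB hP mulmxBl !mulmxBr PP !raddfB /=.
by rewrite -mxtraceC trmxC_mul hP opprK addrA.
Qed.

End Adjoint.

(** * The matched projection of an idempotent *)

Section MatchedProjection.
Variables (C : numClosedFieldType) (n : nat) (Q : 'M[C]_n).
Hypothesis QQ : Q *m Q = Q.

Let T := mxabs (Q^t*).
Let S := mpinv T.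
Let E := T *m S.
Let W := invmx (T + 1%:M).

Let hT : T^t* = T.
Proof. by have [[/hermsymmxC]] := mxabsP (Q^t*). Qed.

Let TT : T *m T = Q *m Q^t*.
Proof. by have [_] := mxabsP (Q^t*); rewrite trmxCK. Qed.

Let hS : S^t* = S. Proof. exact: mpinv_herm. Qed.

Let hE : E^t* = E.
Proof. by have [_ _ /hermsymmxC] := mpinvP T. Qed.

Let ST : S *m T = E.
Proof. by rewrite -hE trmxC_mul hT hS. Qed.

Let ET : E *m T = T.
Proof. by have [] := mpinvP T. Qed.

Let TE : T *m E = T.
Proof. by rewrite -hT -{1}hE -trmxC_mul ET. Qed.

Let EE : E *m E = E.
Proof. by rewrite mulmxA ET. Qed.

(** [(1 - E) Q Q^* = (1 - E) T T = 0], so a Gram matrix built from [(1 - E) Q] vanishes. *)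
Let EQ : E *m Q = Q.
Proof.
apply/eqP; rewrite eq_sym -subr_eq0 -{1}[Q]mul1mx -mulmxBl -[_ *m Q]trmxCK.
rewrite (@gram_eq0 _ _ _ ((_ *m Q)^t*)) ?trmx0 ?map_mx0 // trmxCK trmxC_mul.
by rewrite mulmxA -(mulmxA _ Q) -TT mulmxA mulmxBl mul1mx ET subrr !mul0mx.
Qed.

(** [T = T T S = Q Q^* S] has [Q] as its left factor, and [Q] is idempotent. *)
Let QT : Q *m T = T.
Proof.
have TQ : T = Q *m Q^t* *m S by rewrite -TT -mulmxA -/E TE.
by rewrite [in LHS]TQ !mulmxA QQ -TQ.
Qed.

Let QE : Q *m E = E.
Proof. by rewrite mulmxA QT. Qed.

Let uW : T + 1%:M \in unitmx.
Proof. exact: mxabs_add1_unit. Qed.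

Let UW : (T + 1%:M) *m W = 1%:M. Proof. exact: mulmxV. Qed.

Let WU : W *m (T + 1%:M) = 1%:M. Proof. exact: mulVmx. Qed.

Let hW : W^t* = W.
Proof. by rewrite /W trmx_inv map_invmx trmxCD trmx1 map_mx1 hT. Qed.

Let invmx_comm (X : 'M[C]_n) : T *m X = X *m T -> W *m X = X *m W.
Proof.
move=> TX; have UX : (T + 1%:M) *m X = X *m (T + 1%:M).
  by rewrite mulmxDl mulmxDr TX mul1mx mulmx1.
by rewrite -[LHS]mulmx1 -UW mulmxA -(mulmxA W) -UX mulmxA WU mul1mx.
Qed.

Let WS : W *m S = S *m W. Proof. by apply: invmx_comm; rewrite ST. Qed.

Let ES : E *m S = S.
Proof. by rewrite -ST; have [] := mpinvP T. Qed.

(** The middle factor of [m(Q)]; it is Hermitian because [S] and [W] commute. *)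
Let V := S *m W.

Let hV : V^t* = V.
Proof. by rewrite trmxC_mul hW hS. Qed.

Let VTU : V *m (T *m (T + 1%:M)) = E.
Proof. by rewrite mulmxDr mulmx1 -{3}[T]mul1mx -mulmxDl mulmxA -(mulmxA S) WU mulmx1. Qed.

Let TQs : T *m Q^t* = T.
Proof. by rewrite -{1}hT -trmxC_mul QT. Qed.

Let VG : V *m ((T + Q) *m (T + Q^t*)) = 2 *: E.
Proof.
rewrite -VTU scalemxAr; congr (V *m _).
rewrite mulmxDl !mulmxDr TQs QT -TT mulmx1 scaler_nat mulr2n; congr (_ + _).
exact: addrC.
Qed.

Let mE : matched_proj Q = 2^-1 *: ((T + Q^t*) *m V *m (T + Q)).
Proof. by rewrite /matched_proj -!scalemxAl mulmxA. Qed.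

Lemma matched_proj_herm : (matched_proj Q)^t* = matched_proj Q.
Proof.
rewrite mE linearZ /= map_mxZ /= 2!trmxC_mul hV !trmxCD trmxCK hT mulmxA.
by rewrite fmorphV rmorph_nat.
Qed.

(** The inner factors collapse to [2 E] by [VG]; [E V = V], and the 2 cancels one of the two
    halves. *)
Lemma matched_proj_idem : matched_proj Q *m matched_proj Q = matched_proj Q.
Proof.
have AVB (X Y : 'M[C]_n) :
    (X *m V *m Y) *m (X *m V *m Y) = X *m (V *m (Y *m X)) *m V *m Y.
  by rewrite !mulmxA.
rewrite mE -scalemxAl -scalemxAr AVB VG -scalemxAr -!scalemxAl.
rewrite -(mulmxA _ E) [E *m V]mulmxA ES !scalerA.
by rewrite divfK ?pnatr_eq0.
Qed.

Lemma mxtrace_matched_proj : \tr (matched_proj Q) = \tr Q.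
Proof.
rewrite mE -mulmxA mxtraceZ mxtrace_mulC -mulmxA VG mxtraceZ mulKf ?pnatr_eq0 //.
by rewrite -QE mxtrace_mulC EQ.
Qed.

Lemma mxtrace_matched_projM :
  \tr (matched_proj Q *m Q) = 2^-1 * (\tr Q + \tr (mxabs (Q^t*))).
Proof.
have QTQ : Q *m (T + Q^t*) = T *m (T + 1%:M).
  by rewrite mulmxDr QT -TT mulmxDr mulmx1 addrC.
have TQT : (T + Q) *m T = T *m (T + 1%:M).
  by rewrite mulmxDl QT mulmxDr mulmx1.
rewrite mE -scalemxAl mxtraceZ -(mulmxA (_ *m V)) -(mulmxA _ V) mxtrace_mulC.
rewrite -(mulmxA V) -(mulmxA (T + Q)) QTQ (mulmxA (T + Q)) TQT (mulmxA V) VTU.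
rewrite mulmxDr ET mulmx1 mxtraceD addrC; congr (_ * (_ + _)).
by rewrite -QE mxtrace_mulC EQ.
Qed.

(** With [N = Q - E], [N N^* = T T - E = (T - E) (T + 1)]; then [T + 1] is cancelled. *)
Let TsubE : T - E = (Q - E) *m (Q - E)^t* *m W.
Proof.
have EQs : Q^t* *m E = Q^t* by rewrite -{1}hE -trmxC_mul EQ.
have EQs' : E *m Q^t* = E by rewrite -{1}hE -trmxC_mul QE.
apply: (canRL (mulmxK uW)).
have -> : (Q - E) *m (Q - E)^t* = T *m T - E.
  by rewrite trmxCB hE mulmxBl !mulmxBr QE EE -TT EQs' subrr subr0.
by rewrite mulmxBl !mulmxDr ET !mulmx1 addrKA.
Qed.

Let psdW : psdmx W.
Proof.
have -> : W = W^t* *m (T + 1%:M) *m W by rewrite -mulmxA UW mulmx1 hW.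
by apply: psdmx_congr; apply: psdmxD; [have [] := mxabsP (Q^t*) | exact: psdmx1].
Qed.

(** With [X] the square root of [W], cyclicity makes [\tr T - \tr E] the squared Frobenius norm of
    [X N]. If it is zero, then [N = (T + 1) X X N = 0]. *)
Lemma mxtrace_mxabs_idempotent_ge :
  \tr Q <= \tr (mxabs (Q^t*)) ?= iff (Q == Q^t*).
Proof.
have trE : \tr Q = \tr E by rewrite -QE mxtrace_mulC EQ.
have [X [[/hermsymmxC hX _] XX]] := psd_sqrt_ex psdW.
have trTE : \tr T - \tr E = \tr ((X *m (Q - E))^t* *m (X *m (Q - E))).
  rewrite -raddfB TsubE /= -mulmxA mxtrace_mulC trmxC_mul hX -XX !mulmxA.
  by rewrite mxtrace_mulC !mulmxA.
rewrite trE; split; first by rewrite -subr_ge0 trTE mxtrace_gram_ge0.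
apply/eqP/eqP => [TE0 | hQ].
  suff /eqP : Q - E = 0 by rewrite subr_eq0 => /eqP ->.
  have /mxtrace_gram_eq0 XN : \tr ((X *m (Q - E))^t* *m (X *m (Q - E))) = 0.
    by rewrite -trTE TE0 subrr.
  by rewrite -[LHS]mul1mx -UW -XX -!mulmxA XN !mulmx0.
(* For Hermitian [Q], the adjoint of [Q E = E] reads [E Q = E], while [E Q = Q]. *)
have EQ' : E = Q by rewrite -hE -QE trmxC_mul hE -hQ EQ.
by apply/eqP; rewrite eq_sym -subr_eq0 trTE EQ' subrr mulmx0 mulmx0 mxtrace0.
Qed.

End MatchedProjection.

(** * Frobenius norms, ranks and the inequality *)

Lemma frobenius_norm_ge0 (R : rcfType) m n (A : 'M[R[i]]_(m, n)) :
  0 <= frobenius_norm A.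
Proof. exact: sqrtr_ge0. Qed.

(** The real norm is embedded in [R[i]], where the trace identities live. *)
Lemma sqr_frobenius_norm (R : rcfType) m n (A : 'M[R[i]]_(m, n)) :
  (frobenius_norm A ^+ 2)%:C%C = \tr (A^t* *m A).
Proof.
rewrite sqr_sqrtr; last by do 2!apply: sumr_ge0 => ? _; rewrite sqr_ge0.
rewrite mxtrace_gram exchange_big /= rmorph_sum; apply: eq_bigr => i _.
by rewrite rmorph_sum; apply: eq_bigr => j _; rewrite rmorphXn.
Qed.

Lemma drazin_idem (C : numClosedFieldType) n (A : 'M[C]_n) :
  (A *m drazin A) *m (A *m drazin A) = A *m drazin A.
Proof. by have [_ XAX _] := drazinP A; rewrite -mulmxA (mulmxA (drazin A)) XAX. Qed.

Lemma mxrank_mul_drazin (C : numClosedFieldType) n (A : 'M[C]_n) :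
  \rank (A *m drazin A) = \rank (drazin A).
Proof.
have [_ XAX _] := drazinP A; apply/eqP; rewrite eqn_leq mxrankM_maxr.
by rewrite -{1}XAX -mulmxA mxrankM_maxr.
Qed.

Lemma mxrank_mul_mpinv (C : numClosedFieldType) m n (A : 'M[C]_(m, n)) :
  \rank (A *m mpinv A) = \rank A.
Proof.
have [AXA _ _ _] := mpinvP A; apply/eqP; rewrite eqn_leq mxrankM_maxl.
by rewrite -{1}AXA mxrankM_maxl.
Qed.

(** In both expansions [\tr (Q^* Q)] occurs once and cancels. All other traces are real, so
    conjugation disappears and a linear identity remains. *)
Lemma sqr_frobenius_mpinvB_drazin (R : rcfType) n (A : 'M[R[i]]_n) :
  let Q := A *m drazin A in
  (frobenius_norm (A *m mpinv A - Q) ^+ 2)%:C%C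
  = (frobenius_norm (matched_proj Q - Q) ^+ 2
     + (\rank A)%:R - (\rank (drazin A))%:R)%:C%C
    + (\tr (mxabs (Q^t*)) - \tr Q).
Proof.
move=> Q; have QQ : Q *m Q = Q by exact: drazin_idem.
have [AXA _ /hermsymmxC hP _] := mpinvP A.
have trQ : \tr Q = (\rank (drazin A))%:R.
  by rewrite mxtrace_idempotent // mxrank_mul_drazin.
have PP : A *m mpinv A *m (A *m mpinv A) = A *m mpinv A by rewrite mulmxA AXA.
have PQ : A *m mpinv A *m Q = Q by rewrite mulmxA AXA.
have hT : (\tr (mxabs (Q^t*)))^* = \tr (mxabs (Q^t*)).
  by have [[/hermsymmxC hT _] _] := mxabsP (Q^t*); rewrite -mxtraceC hT.
rewrite rmorphB rmorphD /= !rmorph_nat !sqr_frobenius_norm.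
rewrite (mxtrace_gram_projB _ PP hP).
rewrite (mxtrace_gram_projB _ (matched_proj_idem QQ) (matched_proj_herm Q)).
rewrite PQ mxtrace_matched_proj // mxtrace_matched_projM // rmorphM rmorphD /=.
rewrite hT fmorphV trQ !rmorph_nat mxtrace_idempotent // mxrank_mul_mpinv.
by field.
Qed.

Theorem corollary5p6 (R : realType) (n : nat) (n_gt0 : (0 < n)%N)
    (A : 'M[R[i]]_n) :
  frobenius_norm (A *m mpinv A - A *m drazin A) >=
    Num.sqrt (frobenius_norm (matched_proj (A *m drazin A) - A *m drazin A) ^+ 2
              + (\rank A)%:R - (\rank (drazin A))%:R)
  /\ (frobenius_norm (A *m mpinv A - A *m drazin A) =
        Num.sqrt (frobenius_norm (matched_proj (A *m drazin A) - A *m drazin A) ^+ 2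
                  + (\rank A)%:R - (\rank (drazin A))%:R)
      <-> projectionmx (A *m drazin A)).
Proof.
have := sqr_frobenius_mpinvB_drazin A; set Q := A *m drazin A => /= sqE.
have QQ : Q *m Q = Q by exact: drazin_idem.
have [trle treq] := mxtrace_mxabs_idempotent_ge QQ.
set L := frobenius_norm _ in sqE *; set x := _ - _ in sqE *.
have L_ge0 : 0 <= L by exact: frobenius_norm_ge0.
(* [Num.sqrt] is 0 on negative numbers, so the equality case needs a nonnegative radicand; it
   follows from [A^d = A^d A A^d], which bounds the rank of [A^d] by that of [A]. *)
have x_ge0 : 0 <= x.
  have [_ XAX _] := drazinP A.
  rewrite /x -addrA addr_ge0 ?sqr_ge0 // subr_ge0 ler_nat -{1}XAX -mulmxA.
  by rewrite (leq_trans (mxrankM_maxr _ _)) ?mxrankM_maxl.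
have sqB : (L ^+ 2 - x)%:C%C = \tr (mxabs (Q^t*)) - \tr Q.
  by rewrite rmorphB /= sqE addrAC subrr add0r.
split.
  rewrite -(ger0_norm L_ge0) -sqrtr_sqr ler_wsqrtr // -subr_ge0.
  by rewrite -lecR sqB subr_ge0.
have -> : projectionmx Q <-> Q == Q^t*.
  by rewrite -hermsymmxE; split=> [[] | hQ].
(* Equality of the traces is pulled back along the embedding of [R] to [L ^+ 2 = x]. *)
rewrite -treq -[_ == _ :> R[i]]eq_sym -subr_eq0 -sqB (inj_eq (@complexI R)) subr_eq0.
split=> [-> | /eqP <-]; first by rewrite sqr_sqrtr.
by rewrite sqrtr_sqr ger0_norm.
Qed.
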